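(* Let $P$ be a poset and let $P_1,P_2\subseteq P$ be subsets (with the induced orders) such that the square of inclusions $P_1\cap P_2\to P_1$, $P_1\cap P_2\to P_2$, $P_1\to P$, $P_2\to P$ is a pushout $P=P_1\cup_{P_1\cap P_2}P_2$ in the category $\mathrm{Pos}$ of posets and monotone maps, and such that all the order embeddings in this square are continuous and have the restriction property. Then the induced maps are order embeddings and form a pushout diagram in $\mathrm{Pos}$, $$\lambda(P)=\lambda(P_1)\cup_{\lambda(P_1\cap P_2)}\lambda(P_2).$$
   Context: For a poset $P$, $\mathrm{Adj}(P)$ is the set of adjoint pairs (monotone Galois connections) $f=(f^*\dashv f_* )$ of monotone maps $f^*,f_*:P\to P$, i.e. $f^*(p)\le q\iff p\le f_*(q)$. For $p,q\in P$, write $p\preceq q$ if there is $f\in\mathrm{Adj}(P)$ with $f^*(q)=p$ and $f_*(p)=q$. This is a preorder on $P$, and the fundamental poset $\lambda(P)$ is its posetal reflection. A monotone map $h:Q\to P$ is continuous if $q\preceq q'$ (taxotopy in $Q$) implies $h(q)\preceq h(q')$ (taxotopy in $P$); a continuous map induces a monotone map $\lambda(Q)\to\lambda(P)$. An order embedding $i:Q\to P$ has the restriction property if every $f\in\mathrm{Adj}(P)$ restricts to an adjunction $f|_Q\in\mathrm{Adj}(Q)$, i.e. there is $f|_Q\in\mathrm{Adj}(Q)$ with $i\circ (f|_Q)^*=f^*\circ i$ and $i\circ (f|_Q)_*=f_*\circ i$. *)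

(* Defs.v *)
From HB Require Import structures.
From mathcomp Require Import all_boot all_order.
From mathcomp Require Import boolp classical_sets functions.

Set Implicit Arguments.
Unset Strict Implicit.
Unset Printing Implicit Defensive.

Import Order.TTheory.
Local Open Scope order_scope.
Local Open Scope classical_set_scope.
Local Open Scope quotient_scope.

(* A poset is a [porderType] and an arrow of Pos is an [{omorphism _ -> _}].
   As classical logic is assumed, decidability of the order and the choice
   operator carried by a [porderType] are no restriction. *)

HB.instance Definition _ d (P : porderType d) (A : pred P) :=
  [SubChoice_isSubPOrder of {x : P | A x} by <: with d].

Section Inclusions.
Context d (P : porderType d).

Fact val_set_homo (A : set P) : {homo (\val : A -> P) : x y / x <= y}.
Proof. by []. Qed.

Fact subfun_homo (A B : set P) (AB : A `<=` B) :
  {homo (subfun AB) : x y / x <= y}.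
Proof. by []. Qed.

HB.instance Definition _ (A B : set P) (AB : A `<=` B) :=
  Order.isOrderMorphism.Build d A d B (subfun AB) (@subfun_homo A B AB).

Definition inclusion (A : set P) : {omorphism A -> P} :=
  HB.pack (\val : A -> P)
    (Order.isOrderMorphism.Build d A d P \val (@val_set_homo A)).

Definition inclusionIl (A B : set P) : {omorphism (A `&` B) -> A} :=
  subfun (@subIsetl P A B).

Definition inclusionIr (A B : set P) : {omorphism (A `&` B) -> B} :=
  subfun (@subIsetr P A B).
End Inclusions.

Section Pushout.
Context dA (A : porderType dA) dB (B : porderType dB).
Context dC (C : porderType dC) dD (D : porderType dD).

Definition is_pushout (f : {omorphism A -> B}) (g : {omorphism A -> C})
    (h : {omorphism B -> D}) (k : {omorphism C -> D}) : Prop :=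
  h \o f =1 k \o g /\
  forall dT (T : porderType dT) (u : {omorphism B -> T})
      (v : {omorphism C -> T}), u \o f =1 v \o g ->
    exists w : {omorphism D -> T},
      [/\ w \o h =1 u, w \o k =1 v &
        forall w' : {omorphism D -> T},
          w' \o h =1 u -> w' \o k =1 v -> w' =1 w].
End Pushout.

(* An element f of Adj(P), with [lower f] for f^* and [upper f] for f_*. *)
Record adjunction d (P : porderType d) := Adjunction {
  lower : {omorphism P -> P};
  upper : {omorphism P -> P};
  adjunctionP : forall p q, (lower p <= q) = (p <= upper q)
}.

Section Taxotopy.
Context d (P : porderType d).

Definition taxotopic (p q : P) : Prop :=
  exists f : adjunction P, lower f q = p /\ upper f p = q.

Lemma taxotopic_refl p : taxotopic p p.
Proof. by exists (@Adjunction _ P idfun idfun (fun _ _ => erefl)). Qed.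

Lemma taxotopic_trans q p r :
  taxotopic p q -> taxotopic q r -> taxotopic p r.
Proof.
move=> [f [fq fp]] [g [gr gq]].
have fgP x y : ((lower f \o lower g) x <= y) = (x <= (upper g \o upper f) y).
  by rewrite /= !adjunctionP.
by exists (Adjunction fgP); rewrite /= gr fp.
Qed.

Definition taxotopy_equiv (p q : P) : bool :=
  `[< taxotopic p q /\ taxotopic q p >].

Fact taxotopy_equiv_refl : reflexive taxotopy_equiv.
Proof. by move=> p; apply/asboolP; split; apply: taxotopic_refl. Qed.

Fact taxotopy_equiv_sym : symmetric taxotopy_equiv.
Proof. by move=> p q; apply: asbool_equiv_eq; split=> -[]. Qed.

Fact taxotopy_equiv_trans : transitive taxotopy_equiv.
Proof.
move=> q p r /asboolP[pq qp] /asboolP[qr rq].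
by apply/asboolP; split; apply: (@taxotopic_trans q).
Qed.

Canonical taxotopy_equiv_rel := EquivRel taxotopy_equiv
  taxotopy_equiv_refl taxotopy_equiv_sym taxotopy_equiv_trans.

(* The fundamental poset lambda(P). *)
Definition fundamental_poset : Type := {eq_quot taxotopy_equiv}.

HB.instance Definition _ := Choice.on fundamental_poset.
HB.instance Definition _ := EqQuotient.on fundamental_poset.

Definition fundamental_le (x y : fundamental_poset) : bool :=
  `[< taxotopic (repr x) (repr y) >].

Lemma taxotopy_equivP (p q : P) :
  reflect (taxotopic p q /\ taxotopic q p)
          (\pi_fundamental_poset p == \pi_fundamental_poset q).
Proof. by rewrite eqquotE; apply: asboolP. Qed.

Lemma fundamental_le_pi (p q : P) :
  fundamental_le (\pi p) (\pi q) = `[< taxotopic p q >].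
Proof.
have [p1 p2] := taxotopy_equivP _ _ (introT eqP (reprK (\pi_fundamental_poset p))).
have [q1 q2] := taxotopy_equivP _ _ (introT eqP (reprK (\pi_fundamental_poset q))).
apply: asbool_equiv_eq; split=> pq.
  exact: taxotopic_trans p2 (taxotopic_trans pq q1).
exact: taxotopic_trans p1 (taxotopic_trans pq q2).
Qed.

Fact fundamental_le_refl : reflexive fundamental_le.
Proof. by move=> x; apply/asboolP; apply: taxotopic_refl. Qed.

Fact fundamental_le_anti : antisymmetric fundamental_le.
Proof.
move=> x y /andP[/asboolP xy /asboolP yx].
by rewrite -[x]reprK -[y]reprK; apply/eqP/taxotopy_equivP.
Qed.

Fact fundamental_le_trans : transitive fundamental_le.
Proof.
move=> y x z /asboolP xy /asboolP yz.
by apply/asboolP; apply: taxotopic_trans xy yz.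
Qed.

HB.instance Definition _ := Order.Le_isPOrder.Build d fundamental_poset
  fundamental_le_refl fundamental_le_anti fundamental_le_trans.

Lemma le_pi (p q : P) :
  ((\pi p : fundamental_poset) <= \pi q) = `[< taxotopic p q >].
Proof. exact: fundamental_le_pi. Qed.
End Taxotopy.

Section MapsOfPosets.
Context dQ (Q : porderType dQ) dP (P : porderType dP).

Definition taxotopy_continuous (h : {omorphism Q -> P}) : Prop :=
  forall q q', taxotopic q q' -> taxotopic (h q) (h q').

Definition restriction_property (i : {omorphism Q -> P}) : Prop :=
  {mono i : x y / x <= y} /\
  forall f : adjunction P, exists g : adjunction Q,
    i \o lower g =1 lower f \o i /\ i \o upper g =1 upper f \o i.

Section Lambda.
Context (h : {omorphism Q -> P}) (ch : taxotopy_continuous h).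

(* By [lambda_pi] this is the map induced by h on classes. *)
Definition lambda of taxotopy_continuous h :
    fundamental_poset Q -> fundamental_poset P :=
  fun x => \pi_(fundamental_poset P) (h (repr x)).

Lemma lambda_pi q : lambda ch (\pi q) = \pi_(fundamental_poset P) (h q).
Proof.
have [q1 q2] :=
  taxotopy_equivP _ _ (introT eqP (reprK (\pi_(fundamental_poset Q) q))).
by apply/eqP/taxotopy_equivP; split; apply: ch.
Qed.

Fact lambda_homo : {homo lambda ch : x y / x <= y}.
Proof.
by move=> x y /asboolP xy; rewrite le_pi; apply/asboolP; apply: ch.
Qed.

HB.instance Definition _ := Order.isOrderMorphism.Build dQ
  (fundamental_poset Q) dP (fundamental_poset P) (lambda ch) lambda_homo.
End Lambda.
End MapsOfPosets.

(* Main.v *)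
Require Import Defs.
From HB Require Import structures.
From mathcomp Require Import all_boot all_order.
From mathcomp Require Import boolp classical_sets functions.

Import Order.TTheory.
Local Open Scope order_scope.
Local Open Scope classical_set_scope.
Local Open Scope quotient_scope.

(** Let i : Q -> P be continuous with the restriction property. If f in Adj(P) witnesses
    i q ⪯ i q', then its restriction to Q witnesses q ⪯ q'; so taxotopy in Q
    is exactly taxotopy in P between points of Q, which makes the four induced
    maps order embeddings ([lambda_mono]). If f witnesses p ⪯ q in P, then
    p = f^* q and q = f_* p, and as f restricts to P1 and to P2, each of these
    subsets contains p if and only if it contains q ([taxotopic_in]). Hence an
    inequality in lambda(P) between a class from P1 and a class from P2 already
    lives in lambda(P1 ∩ P2).

    A commutative square of posets whose two maps into D are order embeddings,
    jointly surjective, and such that every inequality in D between points of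
    B and C factors through A, is a pushout ([interpolation_is_pushout]). Joint
    surjectivity for lambda holds because the pushout P is covered by P1 and P2
    ([pushout_cover]): a point p outside both would give two distinct monotone
    maps P -> bool, namely p < x and p <= x, that agree on P1 and P2. *)

Section Pushout.
Context {dA} {A : porderType dA} {dB} {B : porderType dB}.
Context {dC} {C : porderType dC} {dD} {D : porderType dD}.
Context {f : {omorphism A -> B}} {g : {omorphism A -> C}}.
Context {h : {omorphism B -> D}} {k : {omorphism C -> D}}.

Lemma interpolation_is_pushout :
  h \o f =1 k \o g ->
  {mono h : x y / x <= y} -> {mono k : x y / x <= y} ->
  (forall x, (exists b, h b = x) \/ (exists c, k c = x)) ->
  (forall b c, h b <= k c -> exists a, b <= f a /\ g a <= c) ->
  (forall c b, k c <= h b -> exists a, c <= g a /\ f a <= b) ->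
  is_pushout f g h k.
Proof.
move=> hfkg hm km cover hk kh; split=> // dT T u v uv.
have hkT b c : h b <= k c -> u b <= v c.
  move=> /hk[a [ba ac]]; apply: le_trans (omorph_le u ba) _.
  by rewrite [u (f a)](uv a) /=; apply: omorph_le.
have khT c b : k c <= h b -> v c <= u b.
  move=> /kh[a [ca ab]]; apply: le_trans (omorph_le v ca) _.
  by rewrite -[v (g a)](uv a) /=; apply: omorph_le.
have /choice[w wP] x : exists t,
    (forall b, h b = x -> t = u b) /\ (forall c, k c = x -> t = v c).
  have [[b bx]|[c cx]] := cover x.
  - exists (u b); split=> [b' b'x|c cx].
      by congr (u _); apply/le_anti; rewrite -!hm bx b'x lexx.
    by apply/le_anti; rewrite hkT ?khT // bx cx.
  - exists (v c); split=> [b bx|c' c'x].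
      by apply/le_anti; rewrite hkT ?khT // bx cx.
    by congr (v _); apply/le_anti; rewrite -!km cx c'x lexx.
have wh b : w (h b) = u b by apply: (wP _).1.
have wk c : w (k c) = v c by apply: (wP _).2.
have w_homo : {homo w : x y / x <= y}.
  move=> x y.
  have [[b <-]|[c <-]] := cover x; have [[b' <-]|[c' <-]] := cover y;
    rewrite ?wh ?wk ?hm ?km.
  - exact: omorph_le.
  - exact: hkT.
  - exact: khT.
  - exact: omorph_le.
pose W : {omorphism D -> T} :=
  HB.pack w (Order.isOrderMorphism.Build dD D dT T w w_homo).
exists W; split=> // w' w'h w'k x.
have [[b <-]|[c <-]] := cover x.
- by rewrite [LHS](w'h b) /= wh.
- by rewrite [LHS](w'k c) /= wk.
Qed.

(** For a point x outside both images, the maps [x < _] and [x <= _] into [bool]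
    differ only at x, against the uniqueness of the mediating map. *)
Lemma pushout_cover :
  is_pushout f g h k -> forall x, (exists b, h b = x) \/ (exists c, k c = x).
Proof.
move=> [hfkg univ] x; apply: contrapT => /not_orP[/forallNP xh /forallNP xk].
have le_homo : {homo (fun y : D => x <= y) : y z / y <= z}.
  by move=> y z yz; case xy: (x <= y) => //; rewrite (le_trans xy yz).
have lt_homo : {homo (fun y : D => x < y) : y z / y <= z}.
  by move=> y z yz; case xy: (x < y) => //; rewrite (lt_le_trans xy yz).
pose LE : {omorphism D -> bool} :=
  HB.pack (fun y : D => x <= y) (Order.isOrderMorphism.Build _ D _ bool _ le_homo).
pose LT : {omorphism D -> bool} :=
  HB.pack (fun y : D => x < y) (Order.isOrderMorphism.Build _ D _ bool _ lt_homo).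
have [//|w [_ _ wP]] := univ _ bool (LE \o h) (LE \o k).
  by move=> a /=; rewrite [h (f a)](hfkg a).
have LTE y : y != x -> LT y = LE y by rewrite /= lt_def => ->.
have : LT x = LE x.
  rewrite (wP LE) // (wP LT) // => [b|c]; apply: LTE; apply/eqP.
    exact: xh.
  exact: xk.
by rewrite /= ltxx lexx.
Qed.

End Pushout.

Section Restriction.
Context {dQ} {Q : porderType dQ} {dP} {P : porderType dP}.

Lemma taxotopic_restrict {i : {omorphism Q -> P}} :
  restriction_property i ->
  forall q q', taxotopic (i q) (i q') -> taxotopic q q'.
Proof.
move=> [im ires] q q' [f [fl fu]]; have [g [gl gu]] := ires f.
have i_inj : injective i by move=> x y xy; apply/le_anti; rewrite -!im xy lexx.
exists g; split; apply: i_inj.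
- by rewrite [LHS](gl q').
- by rewrite [LHS](gu q).
Qed.

Lemma lambda_mono {i : {omorphism Q -> P}} (ci : taxotopy_continuous i) :
  restriction_property i -> {mono lambda ci : x y / x <= y}.
Proof.
move=> ri x y; rewrite -[x]reprK -[y]reprK !lambda_pi !le_pi.
by apply: asbool_equiv_eq; split; [apply: taxotopic_restrict | apply: ci].
Qed.

End Restriction.

(** A subset with the restriction property is a union of connected components
    of the taxotopy preorder. *)
Lemma taxotopic_in {d} {P : porderType d} {A : set P} :
  restriction_property (inclusion A) ->
  forall p q, taxotopic p q -> (p \in A) = (q \in A).
Proof.
move=> [_ res] p q [f [fq fp]]; have [g [gl gu]] := res f.
apply/idP/idP => [pA|qA].
- rewrite -fp -[upper f p](gu (exist _ p pA)); exact: valP.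
- rewrite -fq -[lower f q](gl (exist _ q qA)); exact: valP.
Qed.

Theorem theorem9p1 (d : Order.disp_t) (P : porderType d) (P1 P2 : set P)
    (po : is_pushout (inclusionIl P1 P2) (inclusionIr P1 P2)
                     (inclusion P1) (inclusion P2))
    (cI1 : taxotopy_continuous (inclusionIl P1 P2))
    (cI2 : taxotopy_continuous (inclusionIr P1 P2))
    (c1 : taxotopy_continuous (inclusion P1))
    (c2 : taxotopy_continuous (inclusion P2))
    (rI1 : restriction_property (inclusionIl P1 P2))
    (rI2 : restriction_property (inclusionIr P1 P2))
    (r1 : restriction_property (inclusion P1))
    (r2 : restriction_property (inclusion P2)) :
  [/\ {mono lambda cI1 : x y / x <= y}, {mono lambda cI2 : x y / x <= y},
      {mono lambda c1 : x y / x <= y} & {mono lambda c2 : x y / x <= y}] /\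
  is_pushout (lambda cI1) (lambda cI2) (lambda c1) (lambda c2).
Proof.
have [m1 m2] := (lambda_mono c1 r1, lambda_mono c2 r2).
split; first by split=> //; apply: lambda_mono.
have comm : lambda c1 \o lambda cI1 =1 lambda c2 \o lambda cI2.
  by move=> x; rewrite -[x]reprK /= !lambda_pi; congr (\pi _); apply: po.1.
(* The class of a point of P1 that also lies in P2 comes from lambda(P1 ∩ P2),
   and symmetrically. *)
have lift1 p : inclusion P1 p \in P2 -> exists a, lambda cI1 a = \pi p.
  move=> p2; have pI : inclusion P1 p \in P1 `&` P2.
    by rewrite in_setI p2 andbT; apply: valP.
  exists (\pi_(fundamental_poset (P1 `&` P2)) (exist _ (inclusion P1 p) pI)).
  by rewrite lambda_pi; congr (\pi _); apply: val_inj.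
have lift2 p : inclusion P2 p \in P1 -> exists a, lambda cI2 a = \pi p.
  move=> p1; have pI : inclusion P2 p \in P1 `&` P2.
    by rewrite in_setI p1; apply: valP.
  exists (\pi_(fundamental_poset (P1 `&` P2)) (exist _ (inclusion P2 p) pI)).
  by rewrite lambda_pi; congr (\pi _); apply: val_inj.
apply: interpolation_is_pushout => // [x|b c bc|c b cb].
- have [[p px]|[p px]] := pushout_cover po (repr x).
    by left; exists (\pi p); rewrite /= lambda_pi px reprK.
  by right; exists (\pi p); rewrite /= lambda_pi px reprK.
- have [a ab] : exists a, lambda cI1 a = b.
    rewrite -[b]reprK; apply: lift1.
    move: bc; rewrite -[b in X in X -> _]reprK -[c]reprK /= !lambda_pi le_pi.
    by move=> /asboolP /(taxotopic_in r2) ->; apply: valP.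
  exists a; split; first by rewrite /= ab.
  by rewrite /= -m2 -[lambda c2 _](comm a) /= ab.
- have [a ac] : exists a, lambda cI2 a = c.
    rewrite -[c]reprK; apply: lift2.
    move: cb; rewrite -[c in X in X -> _]reprK -[b]reprK /= !lambda_pi le_pi.
    by move=> /asboolP /(taxotopic_in r1) ->; apply: valP.
  exists a; split; first by rewrite /= ac.
  by rewrite /= -m1 [lambda c1 _](comm a) /= ac.
Qed.
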